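(* For $2\le n\le 6$, $\psi(K(n,2))=\alpha(K(n,2))$. For every $n\ge 7$, \[\left\lfloor \frac{\binom{n}{2}}{2}\right\rfloor\le \psi(K(n,2))\le \left\lfloor \frac{\binom{n}{2}+\lfloor n/2\rfloor}{2}\right\rfloor.\] Moreover, if $n\ge 7$ and $n+1\equiv 1$ or $5 \pmod{20}$, then $\psi(K(n,2))=\left\lfloor \frac{\binom{n}{2}+\lfloor n/2\rfloor}{2}\right\rfloor$.
   Context: The Kneser graph $K(n,2)$ has as vertices all $2$-element subsets of $[n]=\{1,\dots,n\}$, two vertices being adjacent iff the subsets are disjoint. An $l$-coloring of a graph $G$ is a surjective map from $V(G)$ onto $[l]$; it is proper if adjacent vertices receive different colors, and complete if for every pair of distinct colors $i,j$ there is an edge $xy$ with $x$ colored $i$ and $y$ colored $j$. The pseudoachromatic number $\psi(G)$ is the largest $l$ for which $G$ has a complete $l$-coloring (not necessarily proper); the achromatic number $\alpha(G)$ is the largest $l$ for which $G$ has a proper complete $l$-coloring. *)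

(* Defs.v *)
From mathcomp Require Import all_boot.

Set Implicit Arguments.
Unset Strict Implicit.
Unset Printing Implicit Defensive.

(* A finite graph is a finType [T] of vertices with an adjacency relation
   [e : rel T]. An l-coloring is a map to ['I_l] satisfying
   [surjective_coloring]; colors are numbered from 0 instead of 1. *)
Section Coloring.
Variables (T : finType) (e : rel T).

Definition surjective_coloring l (f : {ffun T -> 'I_l}) : bool :=
  [forall i, exists x, f x == i].

Definition proper_coloring l (f : {ffun T -> 'I_l}) : bool :=
  [forall x, forall y, e x y ==> (f x != f y)].

Definition complete_coloring l (f : {ffun T -> 'I_l}) : bool :=
  [forall i, forall j, (i != j) ==>
     [exists x, exists y, [&& e x y, f x == i & f y == j]]].

Definition has_complete_coloring l : bool :=
  [exists f : {ffun T -> 'I_l}, surjective_coloring f && complete_coloring f].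

Definition has_proper_complete_coloring l : bool :=
  [exists f : {ffun T -> 'I_l},
     [&& surjective_coloring f, proper_coloring f & complete_coloring f]].

(* By surjectivity no coloring uses more than #|T| colors, so restricting the
   maxima to l <= #|T| loses nothing: see [pseudoachromaticP], [achromaticP]. *)
Definition pseudoachromatic : nat :=
  \max_(l < #|T|.+1 | has_complete_coloring l) l.

Definition achromatic : nat :=
  \max_(l < #|T|.+1 | has_proper_complete_coloring l) l.

Lemma surjective_coloring_leq l (f : {ffun T -> 'I_l}) :
  surjective_coloring f -> l <= #|T|.
Proof.
move=> /forallP sf; rewrite -{1}(card_ord l).
have <- : #|codom f| = #|'I_l|.
  apply: eq_card => i; have /existsP[x /eqP <-] := sf i.
  by rewrite codom_f.
exact: leq_image_card.
Qed.

Lemma has_complete_coloring_leq l : has_complete_coloring l -> l <= #|T|.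
Proof. by move=> /existsP[f /andP[sf _]]; exact: surjective_coloring_leq sf. Qed.

Lemma has_proper_complete_coloring_complete l :
  has_proper_complete_coloring l -> has_complete_coloring l.
Proof.
by move=> /existsP[f /and3P[sf _ cf]]; apply/existsP; exists f; rewrite sf cf.
Qed.

Lemma bigmax_largest (P : pred nat) N :
    (forall l, P l -> l <= N) -> (exists l, P l) ->
  P (\max_(l < N.+1 | P l) l) /\
  (forall l, P l -> l <= \max_(l < N.+1 | P l) l).
Proof.
move=> PN [l0 Pl0]; split=> [|l Pl]; last first.
  have lN : l < N.+1 by rewrite ltnS PN.
  exact: (@leq_bigmax_cond _ (fun i : 'I_N.+1 => P i) (@nat_of_ord _)
            (Ordinal lN) Pl).
have lN : l0 < N.+1 by rewrite ltnS PN.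
have c0 : 0 < #|[pred i : 'I_N.+1 | P i]|.
  by apply/card_gt0P; exists (Ordinal lN).
by have [i Pi ->] := eq_bigmax_cond (@nat_of_ord _) c0.
Qed.

Lemma trivial_complete_coloring : 0 < #|T| -> has_complete_coloring 1.
Proof.
move=> /card_gt0P[x _]; apply/existsP; exists [ffun=> ord0]; apply/andP; split.
  by apply/forallP=> i; apply/existsP; exists x; rewrite (ord1 i) ffunE.
by apply/forallP=> i; apply/forallP=> j; rewrite (ord1 i) (ord1 j) eqxx.
Qed.

Lemma pseudoachromaticP : 0 < #|T| ->
  has_complete_coloring pseudoachromatic /\
  (forall l, has_complete_coloring l -> l <= pseudoachromatic).
Proof.
move=> T0; apply: bigmax_largest; first exact: has_complete_coloring_leq.
by exists 1; exact: trivial_complete_coloring.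
Qed.

(* A proper surjective coloring with the fewest colors is complete: otherwise
   two of its color classes could be merged. *)
Lemma exists_proper_complete_coloring :
  symmetric e -> irreflexive e -> exists l, has_proper_complete_coloring l.
Proof.
move=> esym eirr.
pose Q l := [exists f : {ffun T -> 'I_l},
               surjective_coloring f && proper_coloring f].
have exQ : exists l, Q l.
  exists #|T|; apply/existsP; exists [ffun x => enum_rank x]; apply/andP; split.
    by apply/forallP=> i; apply/existsP; exists (enum_val i);
       rewrite ffunE enum_valK.
  apply/forallP=> x; apply/forallP=> y; apply/implyP=> exy.
  by rewrite !ffunE (inj_eq enum_rank_inj); apply: contraL exy => /eqP->;
     rewrite eirr.
case: (ex_minnP exQ) => l /existsP[f /andP[sf pf]] lmin; exists l.
apply/existsP; exists f; rewrite sf pf /=.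
apply/forallP=> i; apply/forallP=> j; apply/implyP=> nij.
apply: contraT => /existsPn noedge.
have noe x y : e x y -> f x = i -> f y = j -> False.
  move=> exy fx fy; have /existsPn/(_ y) := noedge x.
  by rewrite exy fx fy !eqxx.
case: l f sf pf lmin i j nij {noedge} noe => [|m] f sf pf lmin i j nij noe.
  by case: i {nij noe}.
pose h (k : 'I_m.+1) : 'I_m.+1 := if k == i then j else k.
have hi k : i != h k.
  by rewrite /h; case: (eqVneq k i) => // nk; rewrite eq_sym.
have [g gE] : exists g : 'I_m.+1 -> 'I_m, forall k, lift i (g k) = h k.
  have fin k : {u : 'I_m | lift i u = h k}.
    by have [u hu _] := unlift_some (hi k); exists u; rewrite -hu.
  by exists (fun k => sval (fin k)) => k; case: (fin k).
suff /lmin : Q m by rewrite ltnn.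
apply/existsP; exists [ffun x => g (f x)]; apply/andP; split.
  apply/forallP=> u; have /existsP[x /eqP fx] := forallP sf (lift i u).
  apply/existsP; exists x; rewrite ffunE fx; apply/eqP/(@lift_inj _ i).
  by rewrite gE /h eq_sym (negPf (neq_lift i u)).
apply/forallP=> x; apply/forallP=> y; apply/implyP=> exy; rewrite !ffunE.
apply/eqP=> /(congr1 (lift i)); rewrite !gE /h.
have /eqP nf := implyP (forallP (forallP pf x) y) exy.
case: (eqVneq (f x) i) => [fx|_]; case: (eqVneq (f y) i) => [fy|_] // H.
- by apply: nf; rewrite fx fy.
- by apply: (noe x y) => //; rewrite -H.
- by apply: (noe y x) => //; rewrite esym.
Qed.

Lemma achromaticP : symmetric e -> irreflexive e ->
  has_proper_complete_coloring achromatic /\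
  (forall l, has_proper_complete_coloring l -> l <= achromatic).
Proof.
move=> esym eirr; apply: bigmax_largest.
  move=> l /has_proper_complete_coloring_complete.
  exact: has_complete_coloring_leq.
exact: exists_proper_complete_coloring.
Qed.

End Coloring.

Definition kneser_vertex (n : nat) := {A : {set 'I_n} | #|A| == 2}.

Definition kneser (n : nat) : rel (kneser_vertex n) :=
  fun A B => [disjoint val A & val B].

Lemma kneser_sym n : symmetric (@kneser n).
Proof. by move=> A B; rewrite /kneser disjoint_sym. Qed.

Lemma kneser_irr n : irreflexive (@kneser n).
Proof.
move=> A; rewrite /kneser -setI_eq0 setIid -cards_eq0.
by rewrite (eqP (valP A)).
Qed.

Lemma card_kneser_vertex n : #|{: kneser_vertex n}| = 'C(n, 2).
Proof.
rewrite card_sig -[n in RHS]card_ord -(card_draws 'I_n 2).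
by apply: eq_card => A; rewrite !inE.
Qed.

(* Main.v *)
(* Upper bounds: the one-vertex color classes of a complete coloring are
   pairwise disjoint 2-sets, so there are at most n/2 of them; and a one-vertex
   class bounds the number of colors by one plus the degree of K(n,2).
   The second bound settles n <= 6.

   Lower bounds: view the vertices of K(n,2) as the edges of the complete graph
   on {0, ..., n-1}.  Two color classes that are each a pair of disjoint edges
   can only fail to be adjacent when they span the same four points.  Hence it
   suffices to group the edges (all but at most one) into such pairs with
   distinct supports.  This is done by induction from n to n + 2: with new
   points u, v, the pairs {au, s(a)v}, where s is a cyclic shift of order > 2,
   use up the new edges except uv, which is paired with the edge left over
   before, if any.

   When n = 4m, the bound n^2/4 is attained by making the perfect matching
   {2i, 2i+1} the one-vertex classes, and grouping the other edges into disjoint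
   pairs with distinct supports such that no matching edge meets both edges of
   a pair.  Here the induction goes from n to n + 4. *)
Require Import Defs.
From mathcomp Require Import all_boot.
From mathcomp Require Import zify.

Set Implicit Arguments.
Unset Strict Implicit.
Unset Printing Implicit Defensive.

(** * Lists of edge classes and the colorings they define *)

Definition edge := (nat * nat)%type.

Definition meets (e f : edge) : bool :=
  [|| e.1 == f.1, e.1 == f.2, e.2 == f.1 | e.2 == f.2].

(** The second conjunct makes the classes of a pairwise linked list disjoint, so that each edge gets
    at most one color. *)
Definition linked (C D : seq edge) : bool :=
  has (fun e => has (fun f => ~~ meets e f) D) C && ~~ has [in C] D.

Arguments linked : simpl never.

Definition is_edge n (e : edge) : bool := e.1 < e.2 < n.

Definition edge_set n (e : edge) : {set 'I_n} :=
  [set i : 'I_n | (i == e.1 :> nat) || (i == e.2 :> nat)].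

Lemma kneser_vertexP n (x : kneser_vertex n) :
  exists2 e, is_edge n e & val x = edge_set n e.
Proof.
have /cards2P[i [j [nij xE]]] := valP x.
wlog lij : i j nij xE / i < j.
  move=> H; case: (ltngtP i j) => [ij|ji|/val_inj ij]; first exact: (H i j).
    by apply: (H j i) => //; [rewrite eq_sym | rewrite setUC].
  by rewrite ij eqxx in nij.
exists (nat_of_ord i, nat_of_ord j); first by rewrite /is_edge /= lij ltn_ord.
by apply/setP=> k; rewrite xE !inE.
Qed.

Lemma edge_vertex n e : is_edge n e ->
  exists x : kneser_vertex n, val x = edge_set n e.
Proof.
case: e => a b /andP[/= ab bn]; have an := ltn_trans ab bn.
have eE : edge_set n (a, b) = [set Ordinal an; Ordinal bn].
  by apply/setP=> k; rewrite !inE.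
have e2 : #|edge_set n (a, b)| == 2.
  by rewrite eE cards2 -val_eqE /= neq_ltn ab.
by exists (exist _ (edge_set n (a, b)) e2).
Qed.

Lemma edge_set_inj n e f : is_edge n e -> is_edge n f ->
  edge_set n e = edge_set n f -> e = f.
Proof.
case: e f => a b [c d] /andP[/= ab bn] /andP[/= cd dn] /setP E.
have an := ltn_trans ab bn; have cn := ltn_trans cd dn.
have := E (Ordinal an); have := E (Ordinal bn).
have := E (Ordinal cn); have := E (Ordinal dn).
by rewrite !inE /= => *; congr (_, _); lia.
Qed.

Lemma edge_set_disjoint n e f : is_edge n e -> is_edge n f ->
  [disjoint edge_set n e & edge_set n f] = ~~ meets e f.
Proof.
case: e f => a b [c d] /andP[/= ab bn] /andP[/= cd dn].
have an := ltn_trans ab bn.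
apply/idP/idP => [D|N].
  have := disjointFr D (x := Ordinal an); have := disjointFr D (x := Ordinal bn).
  rewrite !inE /= /meets /= !eqxx orbT => /(_ isT) + /(_ isT); lia.
rewrite -setI_eq0; apply/eqP/setP=> k; rewrite !inE; move: N.
rewrite /meets /=; lia.
Qed.

Lemma linked_coloring n l (L : seq (seq edge)) :
    size L = l.+1 -> all (all (is_edge n)) L -> [::] \notin L ->
    pairwise linked L ->
  exists f : {ffun kneser_vertex n -> 'I_l.+1},
    [/\ surjective_coloring f, complete_coloring (@kneser n) f &
        forall x e (i : 'I_l.+1),
          e \in nth [::] L i -> val x = edge_set n e -> f x = i].
Proof.
move=> sL eL nL pL.
pose has_vertex (x : kneser_vertex n) C := has (fun e => val x == edge_set n e) C.
(* For an edge in no class [find] returns [l.+1], which [inord] turns into color 0; enlarging that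
   class preserves completeness. *)
exists [ffun x => inord (find (has_vertex x) L)]; set f := (X in surjective_coloring X).
have edgeL i e : i < l.+1 -> e \in nth [::] L i -> is_edge n e.
  by move=> il; apply/allP; apply: (allP eL); rewrite mem_nth ?sL.
have linkL i j : i < j -> j < l.+1 -> linked (nth [::] L i) (nth [::] L j).
  move=> ij jl; apply: (pairwiseP [::] pL) => //; rewrite inE sL //.
  exact: ltn_trans jl.
have fE x e (i : 'I_l.+1) :
    e \in nth [::] L i -> val x = edge_set n e -> f x = i.
  move=> ei xe; rewrite /f ffunE.
  suff -> : find (has_vertex x) L = i by rewrite inord_val.
  have iL : i < size L by rewrite sL ltn_ord.
  have hi : has_vertex x (nth [::] L i) by apply/hasP; exists e; rewrite ?xe.
  have hL : has (has_vertex x) L by apply/(has_nthP [::]); exists i.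
  case: (ltngtP (find (has_vertex x) L) i) => // [lt_i|gt_i].
    have /hasP[e' e'i /eqP xe'] := nth_find [::] hL.
    have lt_l := ltn_trans lt_i (ltn_ord i).
    have ee' : e = e'.
      apply: (edge_set_inj (edgeL _ _ (ltn_ord i) ei) (edgeL _ _ lt_l e'i)).
      by rewrite -xe.
    have /andP[_ /hasP[]] := linkL _ _ lt_i (ltn_ord i).
    by exists e; rewrite // ee'.
  by have := before_find [::] gt_i; rewrite hi.
have vertexL (i : 'I_l.+1) e : e \in nth [::] L i ->
    exists2 x : kneser_vertex n, f x = i & val x = edge_set n e.
  move=> ei; have [x xe] := edge_vertex (edgeL _ _ (ltn_ord i) ei).
  by exists x => //; exact: fE ei xe.
split=> //.
  apply/forallP=> i; have : nth [::] L i \in L by rewrite mem_nth ?sL.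
  case E: (nth [::] L i) => [|e C] iL; first by rewrite iL in nL.
  have [|x fx _] := vertexL i e; first by rewrite E mem_head.
  by apply/existsP; exists x; rewrite fx.
have complete_lt (i j : 'I_l.+1) : i < j ->
    exists x y, [/\ kneser x y, f x = i & f y = j].
  move=> ij; have /andP[/hasP[e ei /hasP[e' e'j ee']] _] := linkL _ _ ij (ltn_ord j).
  have [x fx xe] := vertexL _ _ ei; have [y fy ye] := vertexL _ _ e'j.
  exists x, y; split=> //; rewrite /kneser xe ye edge_set_disjoint //.
    exact: edgeL ei.
  exact: edgeL e'j.
apply/forallP=> i; apply/forallP=> j; apply/implyP=> nij.
apply/existsP; case: (ltngtP i j) => [ij|ji|/val_inj ij].
- have [x [y [xy fx fy]]] := complete_lt _ _ ij.
  by exists x; apply/existsP; exists y; rewrite xy fx fy !eqxx.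
- have [x [y [xy fx fy]]] := complete_lt _ _ ji.
  by exists y; apply/existsP; exists x; rewrite kneser_sym xy fx fy !eqxx.
- by rewrite ij eqxx in nij.
Qed.

Lemma linked_pseudoachromatic n (L : seq (seq edge)) : 1 < n ->
    all (all (is_edge n)) L -> [::] \notin L -> pairwise linked L ->
  size L <= pseudoachromatic (@kneser n).
Proof.
move=> n1 eL nL pL; case sL: (size L) => [//|l].
have [f [sf cf _]] := linked_coloring sL eL nL pL.
have T0 : 0 < #|{: kneser_vertex n}| by rewrite card_kneser_vertex bin_gt0.
by apply: (pseudoachromaticP (@kneser n) T0).2; apply/existsP; exists f; rewrite sf.
Qed.

Definition all_edges n : seq edge := [seq (i, j) | j <- iota 0 n, i <- iota 0 j].

Lemma mem_all_edges n e : is_edge n e -> e \in all_edges n.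
Proof.
case: e => a b /andP[/= ab bn]; apply/allpairsPdep; exists b, a.
by rewrite !mem_iota.
Qed.

(** As [L] covers every edge, none gets color 0 by default: each color class is one entry of [L],
    whose edges meet pairwise. *)
Lemma linked_achromatic n (L : seq (seq edge)) : 0 < size L ->
    all (all (is_edge n)) L -> [::] \notin L -> pairwise linked L ->
    all (fun C => all2rel meets C) L -> {subset all_edges n <= flatten L} ->
  size L <= achromatic (@kneser n).
Proof.
case sL: (size L) => [//|l] _ eL nL pL mL coverL.
have [f [sf cf fE]] := linked_coloring sL eL nL pL.
apply: (achromaticP (@kneser_sym n) (@kneser_irr n)).2.
apply/existsP; exists f; rewrite sf cf andbT /=.
have classP x : exists e, [/\ is_edge n e, val x = edge_set n e &
    e \in nth [::] L (f x)].
  have [e en xe] := kneser_vertexP x; exists e; split=> //.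
  have /coverL/flattenP[C /(nthP [::])[i]] := mem_all_edges en.
  rewrite sL => il <- eC; by rewrite (fE x e (Ordinal il)).
apply/forallP=> x; apply/forallP=> y; apply/implyP; apply: contraL => /eqP fxy.
have [e [en xe ei]] := classP x; have [e' [e'n ye e'i]] := classP y.
rewrite /kneser xe ye edge_set_disjoint // negbK.
have /allP/(_ (nth [::] L (f x))) := mL.
rewrite mem_nth ?sL // => /(_ isT)/allrelP; apply=> //.
by rewrite fxy.
Qed.

Lemma achromatic_le_pseudoachromatic n : 1 < n ->
  achromatic (@kneser n) <= pseudoachromatic (@kneser n).
Proof.
move=> n1; have T0 : 0 < #|{: kneser_vertex n}|.
  by rewrite card_kneser_vertex bin_gt0.
apply: (pseudoachromaticP (@kneser n) T0).2.
apply: has_proper_complete_coloring_complete.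
exact: (achromaticP (@kneser_sym n) (@kneser_irr n)).1.
Qed.

(** * Upper bounds on the number of colors *)

Section CompleteColoring.
Variables (n l : nat) (f : {ffun kneser_vertex n -> 'I_l}).
Hypotheses (sf : surjective_coloring f) (cf : complete_coloring (@kneser n) f).

Let class i := [set x | f x == i].
Let singletons := [set i | #|class i| == 1].

Lemma sum_card_class : \sum_i #|class i| = 'C(n, 2).
Proof.
rewrite -card_kneser_vertex -sum1_card (partition_big f predT) //=.
by apply: eq_bigr => i _; rewrite -sum1_card; apply: eq_bigl => x; rewrite !inE.
Qed.

Lemma class_gt0 i : 0 < #|class i|.
Proof.
have /existsP[x fx] := forallP sf i.
by apply/card_gt0P; exists x; rewrite inE.
Qed.

(** Each class has at least two vertices, except the singletons, which fall short by one. *)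
Lemma colors_le_singletons : l.*2 <= 'C(n, 2) + #|singletons|.
Proof.
have -> : #|singletons| = \sum_i (i \in singletons).
  by rewrite -sum1_card big_mkcond; apply: eq_bigr => i _; case: ifP.
have -> : l.*2 = \sum_(i < l) 2 by rewrite sum_nat_const card_ord muln2.
rewrite -sum_card_class -big_split /=.
apply: leq_sum => i _; rewrite inE; have := class_gt0 i.
by case: (#|class i|) => [|[|k]].
Qed.

Lemma edge_of_colors i j : i != j -> exists x y, [/\ kneser x y, f x = i & f y = j].
Proof.
move=> nij; have /forallP/(_ j) := forallP cf i.
by rewrite nij => /existsP[x /existsP[y /and3P[xy /eqP fx /eqP fy]]]; exists x, y.
Qed.

Lemma card_singletons : #|singletons| <= n %/ 2.
Proof.
have rep i : {x | (i \in singletons) ==> (class i == [set x])}.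
  apply: sigW; have /card_gt0P[x xi] := class_gt0 i; exists x.
  rewrite inE; apply/implyP=> /cards1P[y iy]; move: xi.
  by rewrite iy inE => /eqP ->.
have repE i : i \in singletons -> class i = [set sval (rep i)].
  by move=> iS; exact/eqP/(implyP (svalP (rep i)) iS).
pose F i := val (sval (rep i)).
have F2 i : #|F i| = 2 by rewrite (eqP (valP (sval (rep i)))).
have FD : {in singletons &, forall i j, j != i -> [disjoint F i & F j]}.
  move=> i j iS jS nji; have [x [y [xy fx fy]]] := edge_of_colors nji.
  have xj : x \in class j by rewrite inE fx.
  have yi : y \in class i by rewrite inE fy.
  move: xj yi; rewrite (repE i iS) (repE j jS) /F.
  by move=> /set1P <- /set1P <-; rewrite disjoint_sym.
have F0 : set0 \notin [set F i | i in singletons].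
  by apply/imsetP=> -[i _ F0]; have := F2 i; rewrite -F0 cards0.
have [/eqP tF injF] := trivIimset FD F0.
have : \sum_(i in singletons) #|F i| <= n.
  rewrite -(big_imset (fun A : {set _} => #|A|) injF) /= tF.
  by rewrite -[n in _ <= n]card_ord max_card.
rewrite (eq_bigr (fun=> 2)) // sum_nat_const => le_n.
by rewrite leq_divRL.
Qed.

Lemma colors_le_floor : l <= ('C(n, 2) + n %/ 2) %/ 2.
Proof.
rewrite leq_divRL // muln2 (leq_trans colors_le_singletons) //.
by rewrite leq_add2l card_singletons.
Qed.

Lemma kneser_degree (x : kneser_vertex n) : #|[set y | kneser x y]| = 'C(n - 2, 2).
Proof.
have <- : #|~: val x| = n - 2.
  by rewrite cardsCs setCK card_ord (eqP (valP x)).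
rewrite -cards_draws -(card_imset _ val_inj).
apply: eq_card => A; rewrite !inE; apply/imsetP/andP => [[y]|[sA A2]].
  rewrite inE /kneser -disjoints_subset disjoint_sym => D ->.
  by split=> //; exact: valP y.
exists (exist _ A A2) => //; rewrite inE /kneser disjoint_sym.
by rewrite disjoints_subset.
Qed.

Lemma colors_le_degree : l <= maxn 'C(n - 2, 2).+1 ('C(n, 2) %/ 2).
Proof.
rewrite leq_max; case: (set_0Vmem singletons) => [S0|[i]].
  rewrite leq_divRL // muln2 (leq_trans colors_le_singletons) ?orbT //.
  by rewrite S0 cards0 addn0.
rewrite inE => /cards1P[x ix]; apply/orP; left.
rewrite -(kneser_degree x); set N := [set y | _].
suff : #|[set~ i]| <= #|f @: N|.
  rewrite cardsC1 card_ord => /leq_trans/(_ (leq_imset_card _ _)); lia.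
apply/subset_leq_card/subsetP=> j; rewrite !inE eq_sym => nij.
have [y [z [yz fy fz]]] := edge_of_colors nij.
have : y \in class i by rewrite inE fy.
rewrite ix inE => /eqP yx; apply/imsetP; exists z; last by [].
by rewrite inE -yx.
Qed.
End CompleteColoring.

(** * Disjoint pairs of edges and cyclic shifts *)

Definition disjoint_pair n (C : seq edge) : bool :=
  if C is [:: e; f] then [&& is_edge n e, is_edge n f & ~~ meets e f] else false.

(** Addition modulo [n], with a conditional in place of a remainder so that [lia] can treat the two
    cases of [shiftP]. *)
Definition shift n s a := if a + s < n then a + s else a + s - n.

Lemma shiftP n s a : a < n -> s < n ->
  (a + s < n /\ shift n s a = a + s) \/ (n <= a + s /\ shift n s a = a + s - n).
Proof. move=> _ _; rewrite /shift; case: ltnP => ?; [by left | by right]. Qed.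

(** For [s < n] the shift permutes the old points, those below [n], so each edge from an old point
    to [u] or [v] is used once. *)
Definition spokes n s u v : seq (seq edge) :=
  [seq [:: (a, u); (shift n s a, v)] | a <- iota 0 n].

Lemma spokesP n s u v C : C \in spokes n s u v ->
  exists2 a, a < n & C = [:: (a, u); (shift n s a, v)].
Proof. by case/mapP=> a; rewrite mem_iota => an ->; exists a. Qed.

Lemma linked_pairE e1 f1 e2 f2 : linked [:: e1; f1] [:: e2; f2] =
  [|| ~~ meets e1 e2, ~~ meets e1 f2, ~~ meets f1 e2 | ~~ meets f1 f2] &&
  [&& e1 != e2, e1 != f2, f1 != e2 & f1 != f2].
Proof.
rewrite /linked /= !inE !orbF -!orbA ![e2 == _]eq_sym ![f2 == _]eq_sym.
congr (_ && _).
by case: (e1 == e2); case: (e1 == f2); case: (f1 == e2); case: (f1 == f2).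
Qed.

Lemma disjoint_pairP n C : disjoint_pair n C ->
  exists a b c d, [/\ C = [:: (a, b); (c, d)], a < b < n, c < d < n,
    (a != c) && (a != d) & (b != c) && (b != d)].
Proof.
case: C => [|[a b] [|[c d] []]] //= /and3P[ab cd]; rewrite /meets /=.
by move=> m; exists a, b, c, d; split=> //; move: m; lia.
Qed.

(** The pairs of a and b fail to be linked only if each of a, b is the shift of the other; then n
    divides 2s, which 0 < s < n and 2s <> n exclude. *)
Lemma pairwise_spokes n s u v : 0 < s < n -> s.*2 != n -> n <= u -> n <= v ->
  u != v -> pairwise linked (spokes n s u v).
Proof.
move=> sn s2 nu nv uv; rewrite pairwise_map.
have := iota_uniq 0 n; rewrite uniq_pairwise.
have: all (fun a => a < n) (iota 0 n) by apply/allP=> a; rewrite mem_iota.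
apply: sub_in_pairwise => a b; rewrite /= => an bn ab.
rewrite linked_pairE /meets /= !xpair_eqE.
have [||[? ->]|[? ->]] := @shiftP n s a; try lia;
have [||[? ->]|[? ->]] := @shiftP n s b; lia.
Qed.

(** The old end of a spoke lies on at most one of two disjoint old edges, so the spoke misses the
    other. *)
Lemma linked_spokes n s u v L : n <= u -> n <= v -> s < n ->
  all (disjoint_pair n) L -> allrel linked L (spokes n s u v).
Proof.
move=> nu nv sn dL; apply/allrelP=> C D CL /spokesP[x xn ->].
have [a [b [c [d [-> ? ? ? ?]]]]] := disjoint_pairP (allP dL _ CL).
rewrite linked_pairE /meets /= !xpair_eqE.
have [||[? ->]|[? ->]] := @shiftP n s x; lia.
Qed.

(** * An old edge paired with an edge on two new points *)

Section NewPair.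
Variables (n : nat) (e : edge) (u v : nat).
Hypotheses (en : is_edge n e) (nu : n <= u) (uv : u < v).

Lemma new_pair_disjoint m : v < m -> disjoint_pair m [:: e; (u, v)].
Proof. by move: en; rewrite /= /is_edge /meets /=; lia. Qed.

Lemma linked_new_pair_old C :
  disjoint_pair n C -> e \notin C -> linked [:: e; (u, v)] C.
Proof.
move=> /disjoint_pairP[a [b [c [d [-> ab cd _ _]]]]].
rewrite linked_pairE !inE negb_or => /andP[-> ->] /=.
have -> : meets (u, v) (a, b) = false by rewrite /meets /=; lia.
by rewrite !xpair_eqE !orbT; lia.
Qed.

(** Since uv meets both spokes of each pair, [e] has to miss one of them; this is the condition on
    the shift. *)
Lemma linked_new_pair_spokes s : s < n ->
    (forall a, a < n -> ~~ ((a \in [:: e.1; e.2]) && (shift n s a \in [:: e.1; e.2]))) ->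
  all (linked [:: e; (u, v)]) (spokes n s u v).
Proof.
case: e en => x y; rewrite /is_edge /= => ? sn sP.
apply/allP=> C /spokesP[a an ->].
have := sP a an; rewrite !inE linked_pairE /meets /= !xpair_eqE.
by have [||[? ->]|[? ->]] := @shiftP n s a; lia.
Qed.

(** A spoke at a new point other than [u] and [v] misses the edge uv. *)
Lemma linked_new_pair_other_spokes s u' v' : s < n -> n <= u' -> n <= v' ->
    (u' \notin [:: u; v]) || (v' \notin [:: u; v]) ->
  all (linked [:: e; (u, v)]) (spokes n s u' v').
Proof.
case: e en => x y; rewrite /is_edge /= => ? sn nu' nv'.
rewrite !inE => N; apply/allP=> C /spokesP[a an ->].
rewrite linked_pairE /meets /= !xpair_eqE.
by have [||[? ->]|[? ->]] := @shiftP n s a; lia.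
Qed.
End NewPair.

(** * Packing the edges into disjoint pairs *)

(** The pairs use all edges but at most one; the last clause fixes which one is left over when the
    number of edges is odd. *)
Definition pair_packing n (L : seq (seq edge)) :=
  [/\ size L = 'C(n, 2) %/ 2, all (disjoint_pair n) L, pairwise linked L &
      odd 'C(n, 2) -> (n - 2, n.-1) \notin flatten L].

Lemma disjoint_pairW n m C : n <= m -> disjoint_pair n C -> disjoint_pair m C.
Proof.
move=> nm; case: C => [|e [|f []]] //=; rewrite /is_edge; lia.
Qed.

Lemma all_spokes n m s u v : s < n -> n <= u < m -> n <= v < m -> u != v -> 0 < s ->
  all (disjoint_pair m) (spokes n s u v).
Proof.
move=> sn nu nv uv s0; apply/allP=> C /spokesP[a an ->] /=.
rewrite /is_edge /meets /=.
have [||[? ->]|[? ->]] := @shiftP n s a; lia.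
Qed.

Lemma pair_packing_step n L : 5 <= n -> pair_packing n L ->
  exists L', pair_packing n.+2 L'.
Proof.
move=> n5 [sL dL pL oL].
have binE : 'C(n.+2, 2) = 'C(n, 2) + n.*2.+1 by rewrite !binS !bin1 bin0; lia.
pose M := L ++ spokes n 2 n n.+1.
have dM : all (disjoint_pair n.+2) M.
  rewrite all_cat all_spokes ?andbT; try lia.
  by apply: sub_all dL => C; apply: disjoint_pairW; lia.
have pM : pairwise linked M.
  by rewrite pairwise_cat pL linked_spokes ?pairwise_spokes //; lia.
have sM : size M = 'C(n, 2) %/ 2 + n by rewrite size_cat size_map size_iota sL.
(* If the number of old edges is even, [(n, n.+1)] is left over, as prescribed; if it is odd,
   [(n, n.+1)] is paired with the old edge left over. *)
case o: (odd 'C(n, 2)); last first.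
  exists M; split=> //; first by rewrite sM binE; lia.
  move=> _; apply/flattenP=> -[C]; rewrite mem_cat => /orP[CL|/spokesP[a an ->]].
    have [a [b [c [d [-> ? ? ? ?]]]]] := disjoint_pairP (allP dL _ CL).
    by rewrite !inE !xpair_eqE; lia.
  by rewrite !inE !xpair_eqE; have [||[? ->]|[? ->]] := @shiftP n 2 a; lia.
exists ([:: (n - 2, n.-1); (n, n.+1)] :: M); split.
- by rewrite /= sM binE; lia.
- by rewrite /= dM andbT /is_edge /meets /=; lia.
- rewrite /= pM andbT all_cat.
  have edge_last : is_edge n (n - 2, n.-1) by rewrite /is_edge /=; lia.
  apply/andP; split.
    apply/allP=> C CL; apply: (linked_new_pair_old edge_last) => //.
      exact: (allP dL).
    by apply: contra (oL o) => eC; apply/flattenP; exists C.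
  apply: linked_new_pair_spokes => // [|a an]; first lia.
  by rewrite !inE /=; have [||[? ->]|[? ->]] := @shiftP n 2 a; lia.
- by rewrite binE; lia.
Qed.

Lemma exists_pair_packing n : 5 <= n -> exists L, pair_packing n L.
Proof.
(* The step adds two points, so two consecutive sizes are carried along, from 5 and 6 on. *)
have H k : (exists L, pair_packing k.+4.+1 L) /\ (exists L, pair_packing k.+4.+2 L).
  elim: k => [|k [[L pL] [L' pL']]]; last first.
    by split; [exists L' | apply: (pair_packing_step _ pL)].
  split.
    by exists [:: [:: (0, 1); (2, 3)]; [:: (0, 2); (1, 4)]; [:: (0, 3); (2, 4)];
               [:: (0, 4); (1, 3)]; [:: (1, 2); (3, 4)]].
  by exists [:: [:: (0, 1); (3, 5)]; [:: (0, 2); (3, 4)]; [:: (0, 3); (1, 2)];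
             [:: (0, 4); (1, 5)]; [:: (0, 5); (2, 3)]; [:: (1, 3); (2, 4)];
             [:: (1, 4); (2, 5)]].
case: n => [|[|[|[|[|n]]]]] // _; exact: (H n).1.
Qed.

Lemma pseudoachromatic_ge n : 5 <= n -> 'C(n, 2) %/ 2 <= pseudoachromatic (@kneser n).
Proof.
move=> n5; have [L [<- dL pL _]] := exists_pair_packing n5.
apply: linked_pseudoachromatic => //; first lia.
  by apply: sub_all dL => -[|e [|f []]] //= /and3P[-> ->].
by apply/negP => /(allP dL).
Qed.

(** * Packings compatible with a perfect matching, for n = 4m *)

(** Contracts each matching edge {2i, 2i+1} to i: the images of two edges meet iff some matching
    edge meets both. *)
Definition half_edge (e : edge) : edge := (e.1 %/ 2, e.2 %/ 2).

(* The mate of a point x is the other point with the same value of x %/ 2. *)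
Definition mate_free (C : seq edge) : bool :=
  if C is [:: e; f] then
    [&& e.1 %/ 2 != e.2 %/ 2, f.1 %/ 2 != f.2 %/ 2 &
        ~~ meets (half_edge e) (half_edge f)]
  else false.

(** The pairs use all 8m^2 - 4m edges outside the matching; the 2m matching edges will raise the
    number of classes to 4m^2. *)
Definition mate_packing m (L : seq (seq edge)) :=
  [/\ size L + 2 * m = 4 * m ^ 2,
      all (fun C => disjoint_pair (4 * m) C && mate_free C) L &
      pairwise linked L].

(* The endpoints of e cannot differ both by 2 and by 4 modulo n. *)
Lemma exists_shift_avoiding n (e : edge) : 12 <= n ->
  exists2 s, (s == 2) || (s == 4) &
    forall a, a < n -> ~~ ((a \in [:: e.1; e.2]) && (shift n s a \in [:: e.1; e.2])).
Proof.
case: e => x y n12 /=.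
case: (boolP [exists a : 'I_n,
    (nat_of_ord a \in [:: x; y]) && (shift n 2 a \in [:: x; y])]).
  move=> /existsP[b pb]; exists 4 => // a an; have bn := ltn_ord b.
  move: pb; rewrite !inE.
  have [||[? ->]|[? ->]] := @shiftP n 4 a; try lia;
  have [||[? ->]|[? ->]] := @shiftP n 2 b; lia.
move=> /existsPn H; exists 2 => // a an; exact: (H (Ordinal an)).
Qed.

Lemma mate_pairP n C : disjoint_pair n C && mate_free C ->
  exists a b c d, [/\ C = [:: (a, b); (c, d)], a < b < n, c < d < n,
    (a %/ 2 != b %/ 2) && (c %/ 2 != d %/ 2) &
    [&& a %/ 2 != c %/ 2, a %/ 2 != d %/ 2, b %/ 2 != c %/ 2 & b %/ 2 != d %/ 2]].
Proof.
move=> /andP[/disjoint_pairP[a [b [c [d [-> ab cd _ _]]]]]].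
rewrite /mate_free /half_edge /meets /= => m; exists a, b, c, d; split=> //; lia.
Qed.

(** With [n] even, shifts by 2 or 4 preserve parity, while mates have opposite parity; and no old
    point is the mate of a new one. *)
Lemma mate_spokes n s u v : ~~ odd n -> n <= u -> n <= v -> u %/ 2 != v %/ 2 ->
  (s == 2) || (s == 4) -> 4 < n -> all mate_free (spokes n s u v).
Proof.
move=> n2 nu nv uv s2 n4; apply/allP=> C /spokesP[a an ->].
rewrite /= /half_edge /meets /=.
have [||[? ->]|[? ->]] := @shiftP n s a; lia.
Qed.

(** If every spoke of one pair met every spoke of the other, a and its shift by s would both equal
    b, but 0 < s < n. *)
Lemma linked_mixed_spokes n s t u u' v v' : 0 < s < n -> t < n ->
  n <= u -> n <= u' -> n <= v -> n <= v' -> uniq [:: u; u'; v; v'] ->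
  allrel linked (spokes n s u v) (spokes n t u' v').
Proof.
move=> sn tn nu nu' nv nv' /= U; apply/allrelP=> C D.
move=> /spokesP[a an ->] /spokesP[b bn ->].
have [uu' uv' vu' vv'] : [/\ u != u', u != v', v != u' & v != v'].
  by move: U; rewrite !inE => U; split; lia.
rewrite linked_pairE /meets /= !xpair_eqE.
rewrite (negPf uu') (negPf uv') (negPf vv') (negPf vu').
have [||[? ->]|[? ->]] := @shiftP n s a; try lia;
have [||[? ->]|[? ->]] := @shiftP n t b; lia.
Qed.

Lemma linked_new_pairs n e f u v u' v' : is_edge n e -> is_edge n f -> n <= u ->
  n <= v -> n <= u' -> n <= v' -> e != f -> (u, v) != (u', v') ->
  linked [:: e; (u, v)] [:: f; (u', v')].
Proof.
case: e f => a b [c d]; rewrite /is_edge /= => ab cd nu nv nu' nv' ne nuv.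
rewrite linked_pairE ne nuv.
have -> : meets (a, b) (u', v') = false by rewrite /meets /=; lia.
by rewrite !orbT !xpair_eqE /=; lia.
Qed.

Lemma new_pair_mate_free n e u v : is_edge n e -> ~~ odd n -> n <= u -> n <= v ->
  e.1 %/ 2 != e.2 %/ 2 -> u %/ 2 != v %/ 2 -> mate_free [:: e; (u, v)].
Proof. case: e => a b; rewrite /= /is_edge /half_edge /meets /=; lia. Qed.

(* With new points u, u', v, v' = n, n+1, n+2, n+3 (u, u' mates and v, v' mates),
   the new edges uv, u'v', uv', u'v cannot be paired with one another; two old
   pairs {e1, f1} and {e2, f2} are broken up to provide partners for them. *)
Lemma mate_packing_step m L : 3 <= m -> mate_packing m L ->
  exists L', mate_packing m.+1 L'.
Proof.
move=> m3 [sL dL pL]; set n := 4 * m in dL.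
have n4 : 4 * m.+1 = n.+4 by rewrite /n; lia.
have mE : m.+1 ^ 2 = m ^ 2 + 2 * m + 1 by rewrite -addn1 sqrnD; lia.
have n12 : 12 <= n by rewrite /n; lia.
have n2 : ~~ odd n by rewrite /n; lia.
case: L sL dL pL => [|C1 [|C2 L]] sL; [by move: sL; rewrite /= expnS expn1; nia..|].
have {}sL : size L + 2 + 2 * m = 4 * m ^ 2 by move: sL => /=; clear; lia.
case: C1 => [|e1 [|f1 []]] //=; case: C2 => [|e2 [|f2 []]] //=; rewrite ?andbF //.
move=> /and3P[/andP[/and3P[e1n f1n m1] /and3P[e1m f1m _]]].
move=> /andP[/and3P[e2n f2n m2] /and3P[e2m f2m _]] dL.
move=> /and3P[/andP[/andP[l12 d12] /allP l1] /allP l2 pL].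
have [s s24 sP] := exists_shift_avoiding e1 n12.
have [t t24 tP] := exists_shift_avoiding f1 n12.
have sn : 0 < s < n by move: s24 n12; clear; lia.
have tn : 0 < t < n by move: t24 n12; clear; lia.
have s2 : s.*2 != n by move: s24 n12; clear; lia.
have t2 : t.*2 != n by move: t24 n12; clear; lia.
have /andP[s0 sltn] := sn; have /andP[t0 tltn] := tn.
(* The pairs of [S] have both new points on [(n, n.+2)], those of [T] on [(n.+1, n.+3)]; hence the
   choice of [s] for [e1] and [t] for [f1]. The new edges in [E2] and [F2] miss a spoke of every
   pair, whatever their partners. *)
pose S := spokes n s n n.+2; pose T := spokes n t n.+1 n.+3.
pose E1 := [:: e1; (n, n.+2)]; pose F1 := [:: f1; (n.+1, n.+3)].
pose E2 := [:: e2; (n, n.+3)]; pose F2 := [:: f2; (n.+1, n.+2)].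
have dL0 : all (disjoint_pair n) L by apply: sub_all dL => C /andP[].
have notin C : C \in L -> [&& e1 \notin C, f1 \notin C, e2 \notin C & f2 \notin C].
  move=> CL; have /andP[_ /hasPn N1] := l1 _ CL; have /andP[_ /hasPn N2] := l2 _ CL.
  apply/and4P; split.
  - by apply/negP => /N1; rewrite /= mem_head.
  - by apply/negP => /N1; rewrite /= !inE eqxx orbT.
  - by apply/negP => /N2; rewrite /= mem_head.
  - by apply/negP => /N2; rewrite /= !inE eqxx orbT.
have linkLST e u v : is_edge n e -> n <= u -> u < v ->
    {in L, forall C, e \notin C} ->
    all (linked [:: e; (u, v)]) S -> all (linked [:: e; (u, v)]) T ->
    all (linked [:: e; (u, v)]) (L ++ S ++ T).
  move=> en nu uv eL lS lT; rewrite !all_cat lS lT !andbT.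
  apply/allP=> C CL; apply: (linked_new_pair_old en nu uv) (eL _ CL).
  exact: (allP dL0).
exists [:: E1, F1, E2, F2 & L ++ S ++ T]; split.
- rewrite /= !size_cat !size_map !size_iota mE; move: sL n4; clear -m3; lia.
- rewrite n4; set P := (X in all X _).
  have newP e u v : is_edge n e -> e.1 %/ 2 != e.2 %/ 2 ->
      [&& n <= u, u < v & v < n.+4] -> u %/ 2 != v %/ 2 -> P [:: e; (u, v)].
    move=> en em /and3P[nu uv vn] uvm.
    have nv := leq_trans nu (ltnW uv).
    by rewrite /P (new_pair_disjoint en nu uv vn) (new_pair_mate_free en n2 nu nv em uvm).
  have all_spokesP r u v : 0 < r < n -> (r == 2) || (r == 4) ->
      [&& n <= u, u < v & v < n.+4] -> u %/ 2 != v %/ 2 -> all P (spokes n r u v).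
    move=> /andP[r0 rn] r24 uvn uvm.
    rewrite all_predI all_spokes ?mate_spokes //; by move: uvn n12; clear; lia.
  rewrite /= !newP ?all_cat ?all_spokesP //; try by move: n2; clear; lia.
  rewrite !andbT; apply: sub_all dL => C /andP[dC mC].
  by rewrite /P mC (disjoint_pairW _ dC) //; clear; lia.
have pLST : pairwise linked (L ++ S ++ T).
  rewrite !pairwise_cat allrel_catr pL /S /T.
  rewrite !(linked_spokes _ _ _ dL0) ?linked_mixed_spokes ?pairwise_spokes //=;
    move: sltn tltn; clear; rewrite ?inE; lia.
rewrite [pairwise _ _]/= pLST andbT.
have [n1 nn2 n3] : [/\ n <= n.+1, n <= n.+2 & n <= n.+3] by split; clear; lia.
have e1L : {in L, forall C, e1 \notin C} by move=> C /notin/and4P[].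
have f1L : {in L, forall C, f1 \notin C} by move=> C /notin/and4P[].
have e2L : {in L, forall C, e2 \notin C} by move=> C /notin/and4P[].
have f2L : {in L, forall C, f2 \notin C} by move=> C /notin/and4P[].
have lE1 : all (linked E1) (L ++ S ++ T).
  apply: linkLST => //; first exact: linked_new_pair_spokes.
  by apply: linked_new_pair_other_spokes => //; rewrite !inE; clear; lia.
have lF1 : all (linked F1) (L ++ S ++ T).
  apply: linkLST => //; last exact: linked_new_pair_spokes.
  by apply: linked_new_pair_other_spokes => //; rewrite !inE; clear; lia.
have lE2 : all (linked E2) (L ++ S ++ T).
  by apply: linkLST; rewrite // linked_new_pair_other_spokes // !inE; clear; lia.
have lF2 : all (linked F2) (L ++ S ++ T).
  by apply: linkLST; rewrite // linked_new_pair_other_spokes // !inE; clear; lia.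
have meets_neq e f : ~~ meets e f -> e != f.
  by apply: contraNneq => ->; rewrite /meets eqxx.
have [ef1 ef2] := (meets_neq _ _ m1, meets_neq _ _ m2).
rewrite /= !inE !orbF !negb_or -!andbA in d12.
have {d12} /and4P[e12 e12' f12 f12'] := d12.
rewrite lE1 lF1 lE2 lF2 /E1 /F1 /E2 /F2 !(@linked_new_pairs n) //;
  rewrite ?xpair_eqE ?(eq_sym e1) ?(eq_sym f1) //; clear; lia.
Qed.

Lemma exists_mate_packing m : 3 <= m -> exists L, mate_packing m L.
Proof.
elim: m => // m IHm; rewrite leq_eqVlt => /orP[/eqP <-|m3].
  (* The 60 edges on 12 points outside the matching, in 30 pairs. *)
  by exists
     [:: [:: (0, 2); (8, 11)]; [:: (0, 3); (6, 10)]; [:: (0, 4); (2, 9)];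
      [:: (0, 5); (7, 8)]; [:: (0, 6); (3, 5)]; [:: (0, 7); (2, 5)];
      [:: (0, 8); (4, 6)]; [:: (0, 9); (2, 11)]; [:: (0, 10); (2, 4)];
      [:: (0, 11); (4, 7)]; [:: (1, 2); (9, 10)]; [:: (1, 3); (5, 8)];
      [:: (1, 4); (3, 11)]; [:: (1, 5); (6, 9)]; [:: (1, 6); (5, 10)];
      [:: (1, 7); (3, 9)]; [:: (1, 8); (5, 6)]; [:: (1, 9); (7, 10)];
      [:: (1, 10); (5, 7)]; [:: (1, 11); (4, 9)]; [:: (2, 6); (4, 11)];
      [:: (2, 7); (5, 11)]; [:: (2, 8); (4, 10)]; [:: (2, 10); (7, 9)];
      [:: (3, 4); (8, 10)]; [:: (3, 6); (9, 11)]; [:: (3, 7); (4, 8)];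
      [:: (3, 8); (6, 11)]; [:: (3, 10); (6, 8)]; [:: (5, 9); (7, 11)]].
by have [L pL] := IHm m3; apply: mate_packing_step m3 pL.
Qed.

Definition perfect_matching m : seq (seq edge) :=
  [seq [:: (i.*2, i.*2.+1)] | i <- iota 0 m.*2].

Lemma pseudoachromatic_ge_square m : 3 <= m ->
  4 * m ^ 2 <= pseudoachromatic (@kneser (4 * m)).
Proof.
move=> m3; have [L [sL dL pL]] := exists_mate_packing m3.
pose M := perfect_matching m.
have MP C : C \in M -> exists2 i, i < m.*2 & C = [:: (i.*2, i.*2.+1)].
  by case/mapP=> i; rewrite mem_iota => im ->; exists i.
have LP C : C \in L -> disjoint_pair (4 * m) C /\ mate_free C.
  by move=> /(allP dL)/andP.
have <- : size (L ++ M) = 4 * m ^ 2.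
  by rewrite size_cat size_map size_iota -sL -muln2 mulnC.
apply: linked_pseudoachromatic; first by move: m3; clear; lia.
- rewrite all_cat; apply/andP; split; last first.
    by apply/allP=> C /MP[i im ->]; rewrite /= /is_edge /= andbT; move: im; clear; lia.
  by apply/allP=> C /LP[+ _]; case: C => [|e [|f []]] //= /and3P[-> ->].
- by rewrite mem_cat negb_or; apply/andP; split; apply/negP; [case/LP | case/MP].
rewrite pairwise_cat pL; apply/andP; split; [|apply/andP; split=> //].
  (* A mate-free pair has an edge that the given matching edge misses, and contains no matching
     edge. *)
  apply/allrelP=> C D /LP[dC mC] /MP[i im ->].
  have [|a [b [c [d [-> _ _ m1 m2]]]]] := @mate_pairP (4 * m) C; first exact/andP.
  rewrite /linked /meets /= !inE !xpair_eqE !orbF; move: m1 m2; clear; lia.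
rewrite pairwise_map; have := iota_uniq 0 m.*2; rewrite uniq_pairwise.
apply: sub_pairwise => i j; rewrite /linked /meets /= !inE !xpair_eqE; clear; lia.
Qed.

(** * Small cases and the theorem *)

(** A proper coloring read off [L] attains the bound of [colors_le_degree], so both numbers equal
    [l]. The conditions on [L] are boolean so that computation checks them. *)
Lemma small_achromatic n l (L : seq (seq edge)) :
    1 < n -> size L = l -> 0 < l ->
    maxn 'C(n - 2, 2).+1 ('C(n, 2) %/ 2) = l ->
    [&& all (all (is_edge n)) L, [::] \notin L, pairwise linked L,
        all (fun C => all2rel meets C) L & all [in flatten L] (all_edges n)] ->
  pseudoachromatic (@kneser n) = achromatic (@kneser n).
Proof.
move=> n1 sL l0 le_l /and5P[eL nL pL mL /allP cL].
have T0 : 0 < #|{: kneser_vertex n}| by rewrite card_kneser_vertex bin_gt0.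
apply/eqP; rewrite eqn_leq achromatic_le_pseudoachromatic // andbT.
apply: (@leq_trans l).
  have [/existsP[f /andP[sf cf]] _] := pseudoachromaticP (@kneser n) T0.
  by rewrite -le_l (colors_le_degree sf cf).
by rewrite -sL; apply: linked_achromatic; rewrite ?sL.
Qed.

Theorem theorem4p1 :
  (forall n : nat, 2 <= n <= 6 ->
     pseudoachromatic (@kneser n) = achromatic (@kneser n)) /\
  (forall n : nat, 7 <= n ->
     'C(n, 2) %/ 2 <= pseudoachromatic (@kneser n)
       <= ('C(n, 2) + n %/ 2) %/ 2) /\
  (forall n : nat, 7 <= n ->
     n + 1 = 1 %[mod 20] \/ n + 1 = 5 %[mod 20] ->
     pseudoachromatic (@kneser n) = ('C(n, 2) + n %/ 2) %/ 2).
Proof.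
have upper n : 7 <= n -> pseudoachromatic (@kneser n) <= ('C(n, 2) + n %/ 2) %/ 2.
  move=> n7; have T0 : 0 < #|{: kneser_vertex n}|.
    by rewrite card_kneser_vertex bin_gt0 (leq_trans _ n7).
  have [/existsP[f /andP[sf cf]] _] := pseudoachromaticP (@kneser n) T0.
  exact: colors_le_floor sf cf.
split; [|split].
- move=> [|[|[|[|[|[|[|n]]]]]]] // _.
  + exact: (@small_achromatic 2 1 [:: [:: (0, 1)]]).
  + exact: (@small_achromatic 3 1 [:: [:: (0, 1); (0, 2); (1, 2)]]).
  + exact: (@small_achromatic 4 3
      [:: [:: (0, 1); (0, 2)]; [:: (0, 3); (2, 3)]; [:: (1, 2); (1, 3)]]).
  + exact: (@small_achromatic 5 5
      [:: [:: (2, 3); (2, 4)]; [:: (0, 1); (0, 2)]; [:: (0, 4); (1, 4)];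
          [:: (0, 3); (3, 4)]; [:: (1, 2); (1, 3)]]).
  + exact: (@small_achromatic 6 7
      [:: [:: (2, 3); (2, 4); (3, 4)]; [:: (0, 4); (0, 5)]; [:: (1, 4); (4, 5)];
          [:: (0, 3); (3, 5)]; [:: (0, 2); (1, 2)]; [:: (1, 5); (2, 5)];
          [:: (0, 1); (1, 3)]]).
- by move=> n n7; rewrite upper // pseudoachromatic_ge // (leq_trans _ n7).
move=> n n7 n20; apply/eqP; rewrite eqn_leq upper //=.
(* Here n is 0 or 4 modulo 20, so 4 divides n, and n >= 20 because n >= 7. *)
have nE : n = 4 * (n %/ 4) by lia.
have m3 : 3 <= n %/ 4 by lia.
have := pseudoachromatic_ge_square m3; rewrite -nE; apply: leq_trans.
(* With n = 4m the upper bound is (8m^2 - 2m + 2m) / 2 = 4m^2. *)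
rewrite {}nE; move: (n %/ 4) => m {n n7 n20 m3}.
by rewrite bin2 expnS expn1; nia.
Qed.
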